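(* Let $\mathbf{C}$ be a firm monoidal category. A morphism $A\to B$ in $\mathcal{S}[\mathbf{C}]$ is restriction-total if and only if it is of the form $[1_I,\ f\circ\rho_A]$ for some morphism $f\colon A\to B$ in $\mathbf{C}$. This induces an isomorphism of categories $\mathbf{C}\cong\mathcal{T}[\mathcal{S}[\mathbf{C}]]$.
   Context: Notation: $\otimes$, $I$, $\lambda_A\colon I\otimes A\to A$, $\rho_A\colon A\otimes I\to A$, $\alpha_{A,B,C}\colon A\otimes(B\otimes C)\to(A\otimes B)\otimes C$ are the monoidal structure; the identity on $A$ is also written $A$. A subunit is a subobject of $I$ represented by a monomorphism $s\colon S\rightarrowtail I$ such that $s\otimes S$ is invertible. A firm monoidal category is a braided monoidal category in which $s\otimes T\colon S\otimes T\to I\otimes T$ is monic for all subunits $s\colon S\rightarrowtail I$, $t\colon T\rightarrowtail I$. The subunits then form a semilattice under $s\wedge t=\lambda_I\circ(s\otimes t)\colon S\otimes T\rightarrowtail I$. For a firm monoidal category $\mathbf C$, the category $\mathcal{S}[\mathbf C]$ has the objects of $\mathbf C$; morphisms $A\to B$ are equivalence classes $[s,f]$ of pairs of a subunit $s\colon S\rightarrowtail I$ and a morphism $f\colon A\otimes S\to B$ of $\mathbf C$, where $(s,f)\sim(s',f')$ iff $s'=s\circ m$ and $f'=f\circ(A\otimes m)$ for an isomorphism $m\colon S'\to S$; identities are $[1_I,\rho_A]$; composition of $[s,f]\colon A\to B$ and $[t,g]\colon B\to C$ is $[t,g]\circ[s,f]=[s\wedge t,\ g\circ(f\otimes T)\circ\alpha_{A,S,T}]$.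 It is a restriction category with restriction $\overline{[s,f]}=[s,\rho_A\circ(A\otimes s)]\colon A\to A$. In a restriction category $\mathbf X$ (a category with a choice of $\overline f\colon A\to A$ for each $f\colon A\to B$, satisfying the usual four restriction axioms), a morphism $f\colon A\to B$ is restriction-total if $\overline f=1_A$; $\mathcal{T}[\mathbf X]$ is the subcategory of restriction-total morphisms. *)

(* Defs.v *)
From mathcomp Require Import all_boot.
From mathcomp Require Import boolp.

Set Implicit Arguments.
Unset Strict Implicit.
Unset Printing Implicit Defensive.

Declare Scope cat_scope.
Delimit Scope cat_scope with cat.
Local Open Scope cat_scope.
Local Open Scope quotient_scope.

Reserved Notation "A ~> B" (at level 70, no associativity).
Reserved Notation "g ∘ f" (at level 40, left associativity).
Reserved Notation "A ⊗ B" (at level 35, no associativity).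
Reserved Notation "f ⊗m g" (at level 35, no associativity).

Record category := Category {
  ob :> Type;
  hom : ob -> ob -> Type;
  idm : forall A, hom A A;
  cmp : forall A B C, hom B C -> hom A B -> hom A C;
  cmp1m : forall A B (f : hom A B), cmp (idm B) f = f;
  cmpm1 : forall A B (f : hom A B), cmp f (idm A) = f;
  cmpA : forall A B C D (h : hom C D) (g : hom B C) (f : hom A B),
    cmp h (cmp g f) = cmp (cmp h g) f
}.
Arguments idm {c} A.
Notation "A ~> B" := (hom A B) : cat_scope.
Notation "g ∘ f" := (cmp g f) : cat_scope.

Definition are_inverse (C : category) (A B : C) (f : A ~> B) (g : B ~> A) :=
  g ∘ f = idm A /\ f ∘ g = idm B.

Definition is_iso (C : category) (A B : C) (f : A ~> B) :=
  exists g : B ~> A, are_inverse f g.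

Definition monic (C : category) (A B : C) (f : A ~> B) :=
  forall (X : C) (x y : X ~> A), f ∘ x = f ∘ y -> x = y.

Definition is_functor (C D : category) (o : C -> D)
    (m : forall A B : C, A ~> B -> o A ~> o B) :=
  (forall A, m A A (idm A) = idm (o A)) /\
  (forall A B E (g : B ~> E) (f : A ~> B), m A E (g ∘ f) = m B E g ∘ m A B f).

Record functor (C D : category) := Functor {
  fob :> C -> D;
  fmap : forall A B : C, A ~> B -> fob A ~> fob B;
  functorP : is_functor fmap
}.

Lemma id_functorP (C : category) :
  is_functor (fun (A B : C) (f : A ~> B) => f).
Proof. by []. Qed.
Definition id_functor (C : category) : functor C C :=
  Functor (@id_functorP C).

Lemma comp_functorP (C D E : category) (G : functor D E) (F : functor C D) :
  is_functor (fun (A B : C) (f : A ~> B) => fmap G (fmap F f)).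
Proof.
case: (functorP G) (functorP F) => [G1 GM] [F1 FM].
by split=> [A|A B X g f]; rewrite ?F1 ?G1 ?FM ?GM.
Qed.
Definition comp_functor (C D E : category) (G : functor D E) (F : functor C D) :
  functor C E := Functor (comp_functorP G F).

Definition is_cat_isomorphism (C D : category) (F : functor C D) :=
  exists G : functor D C,
    comp_functor G F = id_functor C /\ comp_functor F G = id_functor D.

Record restriction_category := RestrictionCategory {
  rcat :> category;
  rst : forall A B : rcat, A ~> B -> A ~> A;
  rst1 : forall (A B : rcat) (f : A ~> B), f ∘ rst f = f;
  rst2 : forall (A B B' : rcat) (f : A ~> B) (g : A ~> B'),
    rst f ∘ rst g = rst g ∘ rst f;
  rst3 : forall (A B B' : rcat) (f : A ~> B) (g : A ~> B'),
    rst (g ∘ rst f) = rst g ∘ rst f;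
  rst4 : forall (A B B' : rcat) (f : A ~> B) (g : B ~> B'),
    rst g ∘ f = f ∘ rst (g ∘ f)
}.

Definition restriction_total (X : restriction_category) (A B : X)
  (f : A ~> B) := rst f = idm A.

Section Total.
Variable X : restriction_category.

Lemma restriction_total_idm (A : X) : restriction_total (idm A).
Proof. by rewrite /restriction_total -[LHS]cmp1m rst1. Qed.

Lemma restriction_total_cmp (A B C : X) (g : B ~> C) (f : A ~> B) :
  restriction_total g -> restriction_total f -> restriction_total (g ∘ f).
Proof.
rewrite /restriction_total => tg tf; have := rst4 f g; rewrite tg cmp1m => e.
by rewrite -tf {2}e rst3 tf cmp1m.
Qed.

Definition total_hom (A B : X) := {f : A ~> B | restriction_total f}.

Lemma total_hom_inj (A B : X) (f g : total_hom A B) : sval f = sval g -> f = g.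
Proof.
by case: f g => [f tf] [g tg] /= e; subst g; congr exist; apply: Prop_irrelevance.
Qed.

Definition total_idm (A : X) : total_hom A A :=
  exist _ (idm A) (restriction_total_idm A).

Definition total_cmp (A B C : X) (g : total_hom B C) (f : total_hom A B) :
    total_hom A C :=
  exist _ (sval g ∘ sval f) (restriction_total_cmp (svalP g) (svalP f)).

Definition total_category : category.
Proof.
refine (@Category X total_hom total_idm total_cmp _ _ _).
- by move=> A B f; apply: total_hom_inj; rewrite /= cmp1m.
- by move=> A B f; apply: total_hom_inj; rewrite /= cmpm1.
- by move=> A B C D h g f; apply: total_hom_inj; rewrite /= cmpA.
Defined.
End Total.

(* The associator is directed A ⊗ (B ⊗ C) -> (A ⊗ B) ⊗ C.  Its inverse is part
   of the data because the second hexagon mentions it. *)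
Record monoidal_category := MonoidalCategory {
  mcat :> category;
  tens : mcat -> mcat -> mcat;
  tensm : forall A A' B B' : mcat,
    A ~> A' -> B ~> B' -> tens A B ~> tens A' B';
  unit_ob : mcat;
  lam : forall A, tens unit_ob A ~> A;
  rho : forall A, tens A unit_ob ~> A;
  alpha : forall A B C, tens A (tens B C) ~> tens (tens A B) C;
  alphaV : forall A B C, tens (tens A B) C ~> tens A (tens B C);
  tensm1 : forall A B, tensm (idm A) (idm B) = idm (tens A B);
  tensmM : forall (A A' A'' B B' B'' : mcat)
    (f : A ~> A') (f' : A' ~> A'') (g : B ~> B') (g' : B' ~> B''),
    tensm (f' ∘ f) (g' ∘ g) = tensm f' g' ∘ tensm f g;
  lam_iso : forall A, is_iso (lam A);
  rho_iso : forall A, is_iso (rho A);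
  alpha_inv : forall A B C, are_inverse (alpha A B C) (alphaV A B C);
  lam_nat : forall (A B : mcat) (f : A ~> B),
    lam B ∘ tensm (idm unit_ob) f = f ∘ lam A;
  rho_nat : forall (A B : mcat) (f : A ~> B),
    rho B ∘ tensm f (idm unit_ob) = f ∘ rho A;
  alpha_nat : forall (A A' B B' C C' : mcat)
    (f : A ~> A') (g : B ~> B') (h : C ~> C'),
    alpha A' B' C' ∘ tensm f (tensm g h) = tensm (tensm f g) h ∘ alpha A B C;
  pentagon : forall A B C D,
    tensm (alpha A B C) (idm D) ∘ alpha A (tens B C) D
      ∘ tensm (idm A) (alpha B C D)
    = alpha (tens A B) C D ∘ alpha A B (tens C D);
  triangle : forall A B,
    tensm (rho A) (idm B) ∘ alpha A unit_ob B = tensm (idm A) (lam B)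
}.
Arguments unit_ob {m}.
Arguments lam {m} A.
Arguments rho {m} A.
Arguments alpha {m} A B C.
Arguments alphaV {m} A B C.
Notation "A ⊗ B" := (tens A B) : cat_scope.
Notation "f ⊗m g" := (tensm f g) : cat_scope.

Record braided_category := BraidedCategory {
  bmon :> monoidal_category;
  braid : forall A B : bmon, A ⊗ B ~> B ⊗ A;
  braid_iso : forall A B, is_iso (braid A B);
  braid_nat : forall (A A' B B' : bmon) (f : A ~> A') (g : B ~> B'),
    braid A' B' ∘ (f ⊗m g) = (g ⊗m f) ∘ braid A B;
  hexagon1 : forall A B C,
    alpha C A B ∘ braid (A ⊗ B) C ∘ alpha A B C
    = (braid A C ⊗m idm B) ∘ alpha A C B ∘ (idm A ⊗m braid B C);
  hexagon2 : forall A B C,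
    alphaV B C A ∘ braid A (B ⊗ C) ∘ alphaV A B C
    = (idm B ⊗m braid A C) ∘ alphaV B A C ∘ (braid A B ⊗m idm C)
}.

(* A representative of a subunit; the passage to subobjects takes place in the
   equivalence relation [pair_equiv] below. *)
Record subunit (C : monoidal_category) := Subunit {
  sdom : C;
  sarr :> sdom ~> unit_ob;
  sarr_monic : monic sarr;
  sarr_idem : is_iso (sarr ⊗m idm sdom)
}.

Record firm_category := FirmCategory {
  fbraided :> braided_category;
  firmP : forall s t : subunit fbraided, monic (s ⊗m idm (sdom t))
}.

Section Isos.
Variable C : category.
Implicit Types A B D : C.

Lemma iso_idm A : is_iso (idm A).
Proof. by exists (idm A); split; rewrite cmp1m. Qed.

Lemma iso_cmp A B D (g : B ~> D) (f : A ~> B) :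
  is_iso g -> is_iso f -> is_iso (g ∘ f).
Proof.
move=> [g' [g1 g2]] [f' [f1 f2]]; exists (f' ∘ g'); split.
  by rewrite -cmpA (cmpA g') g1 cmp1m.
by rewrite -cmpA (cmpA f) f2 cmp1m.
Qed.

Lemma iso_monic A B (f : A ~> B) : is_iso f -> monic f.
Proof.
move=> [g [gf _]] X x y /(congr1 (cmp g)).
by rewrite !cmpA gf !cmp1m.
Qed.

Lemma iso_epi A B (f : A ~> B) D (x y : B ~> D) :
  is_iso f -> x ∘ f = y ∘ f -> x = y.
Proof.
move=> [g [_ fg]] /(congr1 (fun h => h ∘ g)).
by rewrite -!cmpA fg !cmpm1.
Qed.

Lemma iso_inv A B (f : A ~> B) g : are_inverse f g -> is_iso g.
Proof. by move=> [gf fg]; exists f. Qed.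

Lemma monic_cmp A B D (g : B ~> D) (f : A ~> B) :
  monic g -> monic f -> monic (g ∘ f).
Proof. by move=> mg mf X x y; rewrite -!cmpA => /mg /mf. Qed.
End Isos.

Section MonoidalTheory.
Variable C : monoidal_category.
Implicit Types A B D : C.
Local Notation I := (@unit_ob C).

Lemma alpha_iso A B D : is_iso (alpha A B D).
Proof. by exists (alphaV A B D); apply: alpha_inv. Qed.

Lemma alphaV_iso A B D : is_iso (alphaV A B D).
Proof. exact: iso_inv (alpha_inv A B D). Qed.

Lemma tensm_iso A A' B B' (f : A ~> A') (g : B ~> B') :
  is_iso f -> is_iso g -> is_iso (f ⊗m g).
Proof.
move=> [f' [f1 f2]] [g' [g1 g2]]; exists (f' ⊗m g').
by split; rewrite -tensmM ?(f1, g1, f2, g2) tensm1.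
Qed.

Lemma tensmlM A A' A'' B (f : A ~> A') (f' : A' ~> A'') :
  (f' ∘ f) ⊗m idm B = (f' ⊗m idm B) ∘ (f ⊗m idm B).
Proof. by rewrite -tensmM cmp1m. Qed.

Lemma tensmrM A B B' B'' (g : B ~> B') (g' : B' ~> B'') :
  idm A ⊗m (g' ∘ g) = (idm A ⊗m g') ∘ (idm A ⊗m g).
Proof. by rewrite -tensmM cmp1m. Qed.

Lemma tensm_lr A A' B B' (f : A ~> A') (g : B ~> B') :
  (f ⊗m idm B') ∘ (idm A ⊗m g) = f ⊗m g.
Proof. by rewrite -tensmM cmp1m cmpm1. Qed.

Lemma tensm_rl A A' B B' (f : A ~> A') (g : B ~> B') :
  (idm A' ⊗m g) ∘ (f ⊗m idm B) = f ⊗m g.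
Proof. by rewrite -tensmM cmp1m cmpm1. Qed.

Lemma tensI_faithful A B (f g : A ~> B) : idm I ⊗m f = idm I ⊗m g -> f = g.
Proof.
move=> e; apply: (iso_epi (lam_iso A)).
by rewrite -!lam_nat e.
Qed.

Lemma tens_I_faithful A B (f g : A ~> B) : f ⊗m idm I = g ⊗m idm I -> f = g.
Proof.
move=> e; apply: (iso_epi (rho_iso A)).
by rewrite -!rho_nat e.
Qed.

Lemma lam_tens A B : (lam A ⊗m idm B) ∘ alpha I A B = lam (A ⊗ B).
Proof.
apply: tensI_faithful; rewrite tensmrM.
apply: (iso_monic (alpha_iso I A B)).
rewrite cmpA alpha_nat -(triangle I A) tensmlM.
rewrite -!cmpA (cmpA (alpha I I A ⊗m _)) pentagon cmpA.
by rewrite -alpha_nat tensm1 -cmpA triangle.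
Qed.

Lemma rho_tens A B : rho (A ⊗ B) ∘ alpha A B I = idm A ⊗m rho B.
Proof.
apply: tens_I_faithful; rewrite tensmlM.
have iso : is_iso (alpha A (B ⊗ I) I ∘ (idm A ⊗m alpha B I I)).
  apply: iso_cmp; first exact: alpha_iso.
  by apply: tensm_iso; [apply: iso_idm | apply: alpha_iso].
apply: (iso_epi iso).
rewrite -cmpA (cmpA (alpha A B I ⊗m _)) pentagon cmpA triangle.
by rewrite [RHS]cmpA -alpha_nat -cmpA -tensmrM triangle -tensm1 -alpha_nat.
Qed.

Lemma lam_tensI : lam (I ⊗ I) = idm I ⊗m lam I.
Proof. by apply: (iso_monic (lam_iso I)); rewrite lam_nat. Qed.

Lemma rho_tensI : rho (I ⊗ I) = rho I ⊗m idm I.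
Proof. by apply: (iso_monic (rho_iso I)); rewrite rho_nat. Qed.

Lemma lam_rho : lam I = rho I.
Proof.
apply: tens_I_faithful; apply: (iso_epi (alpha_iso I I I)).
by rewrite lam_tens triangle lam_tensI.
Qed.
End MonoidalTheory.

Lemma braid_I (C : braided_category) :
  braid unit_ob unit_ob = idm (@unit_ob C ⊗ unit_ob).
Proof.
set I := @unit_ob C; set b := braid I I; pose l := lam I.
have lI : is_iso l by apply: lam_iso.
suff e : idm I ⊗m (l ∘ b) = idm I ⊗m l.
  by apply: (iso_monic lI); rewrite cmpm1 (tensI_faithful e).
have lbI : is_iso (l ∘ b) by apply: iso_cmp lI (braid_iso _ _).
apply: (iso_monic lbI).
have := hexagon1 I I I; rewrite -/b => /(congr1 (cmp (l ∘ (l ⊗m idm I)))).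
have e1 : l ∘ (l ⊗m idm I) ∘ (alpha I I I ∘ braid (I ⊗ I) I ∘ alpha I I I)
   = l ∘ b ∘ (idm I ⊗m l).
  rewrite -!cmpA (cmpA (l ⊗m _)) lam_tens lam_tensI -/l (cmpA (idm I ⊗m l)).
  by rewrite -braid_nat -/b -(triangle I I) -lam_rho !cmpA.
rewrite e1 => ->.
rewrite -!cmpA (cmpA (l ⊗m _)) -tensmlM.
have natl A (f : A ~> I) : l ∘ (f ⊗m idm I) = f ∘ rho A.
  by rewrite /l lam_rho rho_nat.
rewrite [in RHS](cmpA l) natl -!cmpA.
rewrite (cmpA (rho _)) rho_tensI triangle tensmrM.
by rewrite !cmpA.
Qed.

Section Subunits.
Variable C : firm_category.
Implicit Types (A B D : C) (s t u : subunit C).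
Local Notation I := (@unit_ob C).

Definition middle_swap A B D E : (A ⊗ B) ⊗ (D ⊗ E) ~> (A ⊗ D) ⊗ (B ⊗ E) :=
  alpha A D (B ⊗ E)
  ∘ (idm A ⊗m (alphaV D B E ∘ (braid B D ⊗m idm E) ∘ alpha B D E))
  ∘ alphaV A B (D ⊗ E).

Lemma alphaV_nat A A' B B' D D' (f : A ~> A') (g : B ~> B') (h : D ~> D') :
  alphaV A' B' D' ∘ ((f ⊗m g) ⊗m h) = (f ⊗m (g ⊗m h)) ∘ alphaV A B D.
Proof.
apply: (iso_monic (alpha_iso _ _ _)).
rewrite !cmpA alpha_nat -[RHS]cmpA.
case: (alpha_inv A' B' D') => _ ->; case: (alpha_inv A B D) => _ ->.
by rewrite cmp1m cmpm1.
Qed.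

Lemma middle_swap_iso A B D E : is_iso (middle_swap A B D E).
Proof.
apply: iso_cmp; last exact: alphaV_iso.
apply: iso_cmp; first exact: alpha_iso.
apply: tensm_iso; first exact: iso_idm.
apply: iso_cmp; last exact: alpha_iso.
apply: iso_cmp; first exact: alphaV_iso.
by apply: tensm_iso; [apply: braid_iso | apply: iso_idm].
Qed.

Lemma middle_swap_nat A A' B B' D D' E E'
    (f : A ~> A') (g : B ~> B') (h : D ~> D') (k : E ~> E') :
  middle_swap A' B' D' E' ∘ ((f ⊗m g) ⊗m (h ⊗m k))
  = ((f ⊗m h) ⊗m (g ⊗m k)) ∘ middle_swap A B D E.
Proof.
rewrite /middle_swap -!cmpA alphaV_nat !cmpA -alpha_nat -!cmpA; congr cmp.
rewrite !cmpA; congr cmp.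
rewrite -!tensmM cmp1m cmpm1; congr tensm.
rewrite -!cmpA alpha_nat !cmpA -alphaV_nat -!cmpA; congr cmp.
by rewrite !cmpA -!tensmM braid_nat cmp1m cmpm1.
Qed.

Definition meet_arr s t : sdom s ⊗ sdom t ~> I := lam I ∘ (s ⊗m t).

Lemma meet_monic s t : monic (meet_arr s t).
Proof.
apply: monic_cmp; first exact/iso_monic/lam_iso.
rewrite -(tensm_rl s t); apply: monic_cmp; last exact: firmP.
move=> X x y /(congr1 (cmp (lam I))); rewrite !cmpA !lam_nat -!cmpA.
move=> e; apply: (iso_monic (lam_iso (sdom t))); exact: (@sarr_monic _ t _ _ _ e).
Qed.

Lemma meet_idem s t : is_iso (meet_arr s t ⊗m idm (sdom s ⊗ sdom t)).
Proof.
rewrite /meet_arr tensmlM; apply: iso_cmp.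
  by apply: tensm_iso; [apply: lam_iso | apply: iso_idm].
set S := sdom s; set T := sdom t.
have [w [w1 w2]] := middle_swap_iso I I S T.
have -> : (s ⊗m t) ⊗m idm (S ⊗ T)
    = w ∘ ((s ⊗m idm S) ⊗m (t ⊗m idm T)) ∘ middle_swap S T S T.
  by rewrite -cmpA -middle_swap_nat tensm1 cmpA w1 cmp1m.
apply: iso_cmp; last exact: middle_swap_iso.
apply: iso_cmp; first by exists (middle_swap I I S T).
exact: tensm_iso (sarr_idem s) (sarr_idem t).
Qed.

Definition subunit_meet s t : subunit C :=
  Subunit (@meet_monic s t) (meet_idem s t).

Lemma subunit1_monic : monic (idm I).
Proof. exact/iso_monic/iso_idm. Qed.
Lemma subunit1_idem : is_iso (idm I ⊗m idm I).
Proof. by apply: tensm_iso; apply: iso_idm. Qed.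
Definition subunit1 : subunit C := Subunit subunit1_monic subunit1_idem.

(* s and t represent the same subobject of I. *)
Definition sub_eq s t :=
  exists m : sdom t ~> sdom s, is_iso m /\ t = s ∘ m :> (_ ~> _).

Lemma sub_eq_refl s : sub_eq s s.
Proof. by exists (idm _); rewrite cmpm1; split=> //; apply: iso_idm. Qed.

Lemma sub_eq_sym s t : sub_eq s t -> sub_eq t s.
Proof.
move=> [m [[m' [m1 m2]] e]]; exists m'; split; first by exists m.
by rewrite e -cmpA m2 cmpm1.
Qed.

Lemma sub_eq_trans t s u : sub_eq s t -> sub_eq t u -> sub_eq s u.
Proof.
move=> [m [im e]] [n [ni e']]; exists (m ∘ n); split; first exact: iso_cmp.
by rewrite e' e cmpA.
Qed.

Lemma sub_eq_meet s s' t t' :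
  sub_eq s s' -> sub_eq t t' -> sub_eq (subunit_meet s t) (subunit_meet s' t').
Proof.
move=> [m [im e]] [n [ni e']]; exists (m ⊗m n); split; first exact: tensm_iso.
by rewrite /= /meet_arr e e' tensmM cmpA.
Qed.

Lemma meetA_arr s t u :
  meet_arr (subunit_meet s t) u ∘ alpha _ _ _ = meet_arr s (subunit_meet t u).
Proof.
rewrite /meet_arr /= /meet_arr.
rewrite -[X in lam I ∘ ((lam I ∘ _) ⊗m X)]cmp1m tensmM -!cmpA -alpha_nat.
rewrite (cmpA (lam I ⊗m _)) lam_tens lam_tensI cmpA -!cmpA.
by rewrite -tensmM cmp1m.
Qed.

Lemma sub_eq_meetA s t u : sub_eq
  (subunit_meet (subunit_meet s t) u) (subunit_meet s (subunit_meet t u)).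
Proof. by exists (alpha _ _ _); split; [apply: alpha_iso | rewrite /= meetA_arr]. Qed.

Lemma sub_eq_meetC s t : sub_eq (subunit_meet s t) (subunit_meet t s).
Proof.
exists (braid _ _); split; first exact: braid_iso.
by rewrite /= /meet_arr -cmpA -braid_nat braid_I cmp1m.
Qed.

Lemma meet_lam s t : meet_arr s t = t ∘ (lam _ ∘ (s ⊗m idm _)).
Proof. by rewrite cmpA -lam_nat -cmpA tensm_rl. Qed.

Lemma meet_rho s t : meet_arr s t = s ∘ (rho _ ∘ (idm _ ⊗m t)).
Proof. by rewrite cmpA -rho_nat -cmpA tensm_lr /meet_arr lam_rho. Qed.

Lemma sub_eq_meetss s : sub_eq s (subunit_meet s s).
Proof.
exists (lam _ ∘ (s ⊗m idm _)); split; last exact: meet_lam.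
by apply: iso_cmp; [apply: lam_iso | apply: sarr_idem].
Qed.
End Subunits.

Section SCat.
Variable C : firm_category.
Implicit Types A B D : C.
Local Notation I := (@unit_ob C).

Record sub_pair A B := SubPair {
  psub : subunit C;
  pmor : A ⊗ sdom psub ~> B
}.

Definition pair_equiv A B (p q : sub_pair A B) :=
  exists m : sdom (psub q) ~> sdom (psub p),
    [/\ is_iso m, psub q = psub p ∘ m :> (_ ~> _)
      & pmor q = pmor p ∘ (idm A ⊗m m)].

Lemma pair_equiv_refl A B (p : sub_pair A B) : pair_equiv p p.
Proof.
exists (idm _); rewrite cmpm1 tensm1 cmpm1.
by split=> //; apply: iso_idm.
Qed.

Lemma pair_equiv_sym A B (p q : sub_pair A B) : pair_equiv p q -> pair_equiv q p.
Proof.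
move=> [m [[m' [m1 m2]] e1 e2]]; exists m'; split; first by exists m.
  by rewrite e1 -cmpA m2 cmpm1.
by rewrite e2 -cmpA -tensmrM m2 tensm1 cmpm1.
Qed.

Lemma pair_equiv_trans A B (q p r : sub_pair A B) :
  pair_equiv p q -> pair_equiv q r -> pair_equiv p r.
Proof.
move=> [m [im e1 e2]] [n [ni e3 e4]]; exists (m ∘ n); split.
- exact: iso_cmp.
- by rewrite e3 e1 cmpA.
- by rewrite e4 e2 -cmpA -tensmrM.
Qed.

Definition pair_rel A B (p q : {classic sub_pair A B}) : bool :=
  `[< pair_equiv p q >].

Lemma pair_rel_refl A B : reflexive (@pair_rel A B).
Proof. by move=> p; apply/asboolP/pair_equiv_refl. Qed.
Lemma pair_rel_sym A B : symmetric (@pair_rel A B).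
Proof. by move=> p q; apply/asboolP/asboolP => /pair_equiv_sym. Qed.
Lemma pair_rel_trans A B : transitive (@pair_rel A B).
Proof.
move=> q p r /asboolP pq /asboolP qr; exact/asboolP/(pair_equiv_trans pq qr).
Qed.

Canonical pair_equiv_rel A B := EquivRel (@pair_rel A B)
  (@pair_rel_refl A B) (@pair_rel_sym A B) (@pair_rel_trans A B).

Definition shom A B : Type := {eq_quot (pair_equiv_rel A B)}.

Definition pair_class A B (p : sub_pair A B) : shom A B :=
  \pi_({eq_quot (pair_equiv_rel A B)}) (p : {classic sub_pair A B}).

Definition pair_repr A B (x : shom A B) : sub_pair A B :=
  repr (x : {eq_quot (pair_equiv_rel A B)}).

(* [smor s f] is the class written [s, f]. *)
Definition smor A B (s : subunit C) (f : A ⊗ sdom s ~> B) : shom A B :=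
  pair_class (SubPair f).
Arguments smor {A B} s f.

Lemma pair_classP A B (p q : sub_pair A B) :
  pair_class p = pair_class q <-> pair_equiv p q.
Proof.
rewrite /pair_class; split; first by move/eqmodP/asboolP.
by move=> e; apply/eqmodP/asboolP.
Qed.

Lemma pair_reprK A B (x : shom A B) : pair_class (pair_repr x) = x.
Proof. exact: reprK. Qed.

Lemma repr_equiv A B (p : sub_pair A B) : pair_equiv (pair_repr (pair_class p)) p.
Proof. by apply/pair_classP; rewrite pair_reprK. Qed.

Definition pair_cmp A B D (q : sub_pair B D) (p : sub_pair A B) : sub_pair A D :=
  @SubPair A D (subunit_meet (psub p) (psub q))
    (pmor q ∘ (pmor p ⊗m idm (sdom (psub q)))
      ∘ alpha A (sdom (psub p)) (sdom (psub q))).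

Definition pair_rst A B (p : sub_pair A B) : sub_pair A A :=
  SubPair (rho A ∘ (idm A ⊗m psub p)).

(* Composition and restriction are defined on chosen representatives; [scmpE]
   and [srstE] show that they do not depend on the choice. *)
Definition sidm A : shom A A := smor (subunit1 C) (rho A).
Definition scmp A B D (y : shom B D) (x : shom A B) : shom A D :=
  pair_class (pair_cmp (pair_repr y) (pair_repr x)).
Definition srst A B (x : shom A B) : shom A A := pair_class (pair_rst (pair_repr x)).

Lemma pair_cmp_equiv A B D (q q' : sub_pair B D) (p p' : sub_pair A B) :
  pair_equiv q q' -> pair_equiv p p' -> pair_equiv (pair_cmp q p) (pair_cmp q' p').
Proof.
move: q q' p p' => [t g] [t' g'] [s f] [s' f'].
move=> [n /= [ni e1 e2]] [m /= [im e3 e4]]; exists (m ⊗m n); split => /=.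
- exact: tensm_iso.
- by rewrite /meet_arr e1 e3 tensmM cmpA.
- rewrite e2 e4 -!cmpA alpha_nat; congr cmp; rewrite !cmpA; congr cmp.
  by rewrite -!tensmM cmp1m cmpm1 cmp1m.
Qed.

Lemma pair_rst_equiv A B (p p' : sub_pair A B) :
  pair_equiv p p' -> pair_equiv (pair_rst p) (pair_rst p').
Proof.
move: p p' => [s f] [s' f'] [m /= [im e1 e2]]; exists m; split=> //=.
by rewrite e1 tensmrM cmpA.
Qed.

Lemma scmp_class A B D (q : sub_pair B D) (p : sub_pair A B) :
  scmp (pair_class q) (pair_class p) = pair_class (pair_cmp q p).
Proof. by apply/pair_classP/pair_cmp_equiv; apply: repr_equiv. Qed.

Lemma srst_class A B (p : sub_pair A B) :
  srst (pair_class p) = pair_class (pair_rst p).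
Proof. exact/pair_classP/pair_rst_equiv/repr_equiv. Qed.

Lemma scmpE A B D (t s : subunit C) (g : B ⊗ sdom t ~> D) (f : A ⊗ sdom s ~> B) :
  scmp (smor t g) (smor s f) =
  smor (subunit_meet s t) (g ∘ (f ⊗m idm (sdom t)) ∘ alpha A (sdom s) (sdom t)).
Proof. exact: scmp_class. Qed.

Lemma srstE A B (s : subunit C) (f : A ⊗ sdom s ~> B) :
  srst (smor s f) = smor s (rho A ∘ (idm A ⊗m s)).
Proof. exact: srst_class. Qed.

Lemma smorP A B (x : shom A B) :
  exists (s : subunit C) (f : A ⊗ sdom s ~> B), x = smor s f.
Proof.
rewrite -(pair_reprK x); case: (pair_repr x) => s f.
by exists s, f.
Qed.

Lemma smor_eqP A B (s t : subunit C) (f : A ⊗ sdom s ~> B) (g : A ⊗ sdom t ~> B) :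
  smor s f = smor t g <->
  exists m : sdom t ~> sdom s,
    [/\ is_iso m, t = s ∘ m :> (_ ~> _) & g = f ∘ (idm A ⊗m m)].
Proof. exact: pair_classP. Qed.

Lemma scmp1m A B (x : shom A B) : scmp (sidm B) x = x.
Proof.
have [s [f ->]] := smorP x; rewrite /sidm scmpE; apply/esym/smor_eqP.
exists (rho _); split; first exact: rho_iso.
  by rewrite /= meet_rho /= tensm1 cmpm1.
by rewrite /= rho_nat -cmpA rho_tens.
Qed.

Lemma scmpm1 A B (x : shom A B) : scmp x (sidm A) = x.
Proof.
have [s [f ->]] := smorP x; rewrite /sidm scmpE; apply/esym/smor_eqP.
exists (lam _); split; first exact: lam_iso.
  by rewrite /= meet_lam /= tensm1 cmpm1.
by rewrite /= -cmpA triangle.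
Qed.

Lemma scmpA A B D E (z : shom D E) (y : shom B D) (x : shom A B) :
  scmp z (scmp y x) = scmp (scmp z y) x.
Proof.
have [s [f ->]] := smorP x; have [t [g ->]] := smorP y.
have [u [h ->]] := smorP z; rewrite !scmpE; apply/smor_eqP.
exists (alpha _ _ _); split; first exact: alpha_iso.
  by rewrite /= meetA_arr.
rewrite /= !tensmlM -!cmpA; congr cmp; congr cmp.
by rewrite (cmpA (alpha _ _ _ ⊗m _)) pentagon !cmpA -alpha_nat tensm1.
Qed.

Definition scat : category :=
  @Category C shom sidm scmp scmp1m scmpm1 scmpA.

Lemma cmp_srst A B (s t : subunit C) (g : A ⊗ sdom t ~> B) :
  scmp (smor t g) (smor s (rho A ∘ (idm A ⊗m s))) =
  smor (subunit_meet s t) (g ∘ (idm A ⊗m (lam _ ∘ (s ⊗m idm _)))).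
Proof.
rewrite scmpE; congr smor; rewrite -cmpA tensmlM -cmpA -alpha_nat.
by rewrite (cmpA (rho _ ⊗m _)) triangle tensmrM.
Qed.

Lemma srst_eq A (s t : subunit C) : sub_eq s t ->
  smor s (rho A ∘ (idm A ⊗m s)) = smor t (rho A ∘ (idm A ⊗m t)).
Proof.
move=> [m [im e]]; apply/smor_eqP; exists m; split=> //.
by rewrite e tensmrM cmpA.
Qed.

Lemma srst_cmp_srst A (s t : subunit C) :
  scmp (smor t (rho A ∘ (idm A ⊗m t))) (smor s (rho A ∘ (idm A ⊗m s)))
  = smor (subunit_meet s t) (rho A ∘ (idm A ⊗m subunit_meet s t)).
Proof. by rewrite cmp_srst -cmpA -tensmrM -meet_lam. Qed.

Lemma srst1 A B (x : shom A B) : scmp x (srst x) = x.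
Proof.
have [s [f ->]] := smorP x; rewrite srstE cmp_srst; apply/esym/smor_eqP.
exists (lam _ ∘ (s ⊗m idm _)); split=> //; last by rewrite /= meet_lam.
by apply: iso_cmp; [apply: lam_iso | apply: sarr_idem].
Qed.

Lemma srst2 A B B' (x : shom A B) (y : shom A B') :
  scmp (srst x) (srst y) = scmp (srst y) (srst x).
Proof.
have [s [f ->]] := smorP x; have [t [g ->]] := smorP y.
by rewrite !srstE !srst_cmp_srst; apply/srst_eq/sub_eq_meetC.
Qed.

Lemma srst3 A B B' (x : shom A B) (y : shom A B') :
  srst (scmp y (srst x)) = scmp (srst y) (srst x).
Proof.
have [s [f ->]] := smorP x; have [t [g ->]] := smorP y.
by rewrite (srstE f) cmp_srst (srstE g) srst_cmp_srst srstE.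
Qed.

Lemma srst4 A B B' (x : shom A B) (y : shom B B') :
  scmp (srst y) x = scmp x (srst (scmp y x)).
Proof.
have [s [f ->]] := smorP x; have [t [g ->]] := smorP y.
rewrite scmpE !srstE cmp_srst scmpE; apply/smor_eqP => /=.
have [m [im e]] : sub_eq (subunit_meet s t) (subunit_meet (subunit_meet s t) s).
  apply: sub_eq_trans (sub_eq_meetC _ _).
  apply: sub_eq_trans (sub_eq_meetA _ _ _).
  exact/sub_eq_meet/sub_eq_refl/sub_eq_meetss.
exists m; split=> //=.
have -> : rho B ∘ (idm B ⊗m t) ∘ (f ⊗m idm (sdom t)) ∘ alpha A (sdom s) (sdom t)
    = f ∘ (idm A ⊗m (rho (sdom s) ∘ (idm (sdom s) ⊗m t))).
  rewrite -(cmpA (rho B)) tensm_rl -(tensm_lr f t) cmpA rho_nat -!cmpA.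
  by rewrite -tensm1 -alpha_nat (cmpA (rho _)) rho_tens tensmrM.
rewrite -cmpA -tensmrM; congr (f ∘ (idm A ⊗m _)).
by apply: (@sarr_monic _ s); rewrite -(meet_lam (subunit_meet s t) s) cmpA -meet_rho -e.
Qed.

Definition S_category : restriction_category :=
  @RestrictionCategory scat srst srst1 srst2 srst3 srst4.
End SCat.
Arguments smor {C A B} s f.
Arguments subunit1 C : clear implicits.

(* Main.v *)
Require Import Defs.
From mathcomp Require Import all_boot.
From mathcomp Require Import boolp.
Local Open Scope cat_scope.

Set Implicit Arguments.
Unset Strict Implicit.
Unset Printing Implicit Defensive.

(** If [[s, f]] is restriction-total, then [[s, ρ ∘ (A ⊗ s)] = [1, ρ]] gives an
    isomorphism [m] from [I] to the domain of [s] with [s ∘ m = 1], and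
    transporting [f] along [m] yields [[s, f] = [1, f ∘ (A ⊗ m)]], where
    [f ∘ (A ⊗ m)] factors through the invertible [ρ].  The factor is unique
    because the only [m : I -> I] with [1 = 1 ∘ m] is the identity. *)

(** Both functors share the object map [o], so their morphism maps have the same type and no
    transport along an equality of objects arises. *)
Lemma functor_eq (C D : category) (o : C -> D)
    (m n : forall A B : C, A ~> B -> o A ~> o B)
    (mP : is_functor m) (nP : is_functor n) :
  (forall A B (f : A ~> B), m A B f = n A B f) -> Functor mP = Functor nP.
Proof.
move=> e; have mn : m = n.
  by do 3!apply: functional_extensionality_dep => ?; apply: e.
by subst n; congr Functor; apply: Prop_irrelevance.
Qed.

Section TotalMorphisms.
Variable C : firm_category.
Implicit Types A B D : C.
Local Notation I := (@unit_ob C).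

Definition smor1 A B (f : A ~> B) : shom A B := smor (subunit1 C) (f ∘ rho A).

Lemma smor1_inj A B : injective (@smor1 A B).
Proof.
move=> f g /smor_eqP [m [_ /= e1]]; rewrite cmp1m in e1.
by rewrite -e1 tensm1 cmpm1 => e; apply/esym/(iso_epi (rho_iso A) e).
Qed.

Lemma smor1_id A : smor1 (idm A) = sidm A.
Proof. by rewrite /smor1 cmp1m. Qed.

Lemma smor1_cmp A B D (g : B ~> D) (f : A ~> B) :
  smor1 (g ∘ f) = scmp (smor1 g) (smor1 f).
Proof.
(* The composite lives on [1 ∧ 1], with domain [I ⊗ I], which [λ_I] identifies with [I]; the
   triangle axiom then gives [(ρ_A ⊗ I) ∘ α = A ⊗ λ_I]. *)
rewrite /smor1 scmpE; apply/smor_eqP; exists (lam I); split.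
- exact: lam_iso.
- by rewrite /= /meet_arr tensm1 cmpm1 cmp1m.
- by rewrite /= tensmlM -!cmpA triangle (cmpA (rho B)) rho_nat -!cmpA.
Qed.

Lemma restriction_total_smor1P A B (x : @hom (S_category C) A B) :
  restriction_total x <-> exists f : A ~> B, x = smor1 f.
Proof.
rewrite /restriction_total /=; split; last first.
  by case=> f ->; rewrite srstE /= tensm1 cmpm1.
have [s [f ->]] := smorP x; rewrite srstE.
case/smor_eqP => m [im e _].
have [r [rr _]] := rho_iso A.
exists (f ∘ (idm A ⊗m m) ∘ r); apply/smor_eqP; exists m; split => //.
by rewrite -!cmpA rr cmpm1.
Qed.

Lemma restriction_total_smor1 A B (f : A ~> B) :
  restriction_total (smor1 f : @hom (S_category C) A B).
Proof. by apply/restriction_total_smor1P; exists f. Qed.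

Definition total_smor1 A B (f : A ~> B) :
    @hom (total_category (S_category C)) A B :=
  exist _ _ (restriction_total_smor1 f).

Lemma total_smor1_functor :
  @is_functor C (total_category (S_category C)) (fun A => A) total_smor1.
Proof.
split=> [A|A B D g f]; apply: total_hom_inj => /=; first exact: smor1_id.
exact: smor1_cmp.
Qed.

(** The factor is picked by choice from a mere existence statement; [smor1_inj] makes it unique. *)
Definition total_part A B (x : @hom (total_category (S_category C)) A B) :
    A ~> B :=
  sval (cid ((restriction_total_smor1P (sval x)).1 (svalP x))).

Lemma total_partK A B : cancel (@total_part A B) (@total_smor1 A B).
Proof.
move=> x; apply: total_hom_inj; rewrite /= /total_part.
by case: cid => f /= ->.
Qed.

Lemma total_smor1K A B : cancel (@total_smor1 A B) (@total_part A B).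
Proof.
(* Injectivity turns the one-sided inverse [total_partK] into a two-sided one. *)
by move=> f; apply: smor1_inj; have /(congr1 sval) := total_partK (total_smor1 f).
Qed.

(** The inverse of a functor that is bijective on hom-sets inherits functoriality: each argument is
    rewritten as an image under [total_smor1]. *)
Lemma total_part_functor :
  @is_functor (total_category (S_category C)) C (fun A => A) total_part.
Proof.
have [e1 eM] := total_smor1_functor.
split=> [A|A B D y x]; first by rewrite -e1 total_smor1K.
by rewrite -{1}(total_partK x) -{1}(total_partK y) -eM total_smor1K.
Qed.

Lemma total_smor1_iso : is_cat_isomorphism (Functor total_smor1_functor).
Proof.
(* Both functors are the identity on objects, so [functor_eq] leaves only the two cancellations. *)
exists (Functor total_part_functor); split; apply: functor_eq => A B f /=.
  exact: total_smor1K.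
exact: total_partK.
Qed.
End TotalMorphisms.

Theorem proposition3p17 (C : firm_category) :
  (forall (A B : C) (x : @hom (S_category C) A B),
     restriction_total x <->
     exists f : @hom C A B, x = smor (subunit1 C) (f ∘ rho A)) /\
  (exists (m : forall A B : C,
             @hom C A B -> @hom (total_category (S_category C)) A B)
          (mP : @is_functor C (total_category (S_category C)) (fun A => A) m),
     (forall (A B : C) (f : @hom C A B),
        sval (m A B f) = smor (subunit1 C) (f ∘ rho A)) /\
     is_cat_isomorphism (Functor mP)).
Proof.
split; first exact: restriction_total_smor1P.
exists (@total_smor1 C), (@total_smor1_functor C).
by split; last exact: total_smor1_iso.
Qed.
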